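(* Assume propositional extensionality. If there is a left-cancellable map $f:\mathcal{U}\to\mathcal{U}$ with $f(\mathbf{1})=\mathbf{0}$, then double-negation elimination holds.
   Context: Work in intensional Martin-Löf type theory with $\Pi$-, $\Sigma$-, identity, finite types and natural numbers, and a universe $\mathcal{U}$ closed under these. $\neg X$ is $X\to\mathbf{0}$. A type $P$ is a proposition ($\mathrm{isProp}(P)$) if any two elements are equal. Propositional extensionality: logically equivalent propositions are equal. DNE: $\prod_{P:\mathcal{U}}\mathrm{isProp}(P)\to\neg\neg P\to P$. A map $f$ is left-cancellable if $f(X)=f(Y)$ implies $X=Y$ for all $X,Y$. *)

(* Defs.v *)
From Stdlib Require Import ssreflect ssrfun.

(* A single fixed universe: the map, propositional extensionality and
   double-negation elimination all refer to the same level. *)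
Definition UU := Type.

(* [not] only applies to [Prop]; this is negation for arbitrary types. *)
Definition neg (X : UU) : UU := X -> Empty_set.

Definition isProp (P : UU) := forall x y : P, x = y.

Definition propositional_ext :=
  forall P Q : UU, isProp P -> isProp Q -> (P -> Q) -> (Q -> P) -> P = Q.

(* [P] ranges over all of [UU], so the conclusion is type-valued. *)
Definition DNE := forall P : UU, isProp P -> neg (neg P) -> P.

(* Main.v *)
Require Import Defs.
From Stdlib Require Import ssreflect ssrfun.

(** If [P] held, then [P = unit] and [f P = f unit = Empty_set]; so [f P] is
    empty as soon as [neg (neg P)].  An empty type equals [Empty_set = f unit],
    and left-cancellability gives [P = unit]. *)

(** An empty type is vacuously a proposition, so [pe] applies without assuming [isProp X]; this
    matters for [f P], which is not known to be a proposition. *)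
Lemma empty_eq (pe : propositional_ext) (X : UU) : neg X -> X = Empty_set.
Proof.
by move=> nX; apply: pe.
Qed.

Lemma unit_isProp : isProp unit.
Proof. by case; case. Qed.

Lemma inhabited_prop_eq (pe : propositional_ext) (P : UU) :
  isProp P -> P -> P = unit.
Proof. by move=> propP p; apply: pe => //; exact: unit_isProp. Qed.

Theorem theorem3p7 (pe : propositional_ext) (f : UU -> UU)
  (f_lc : injective f) (f1 : f unit = Empty_set) : DNE.
Proof.
move=> P propP nnP.
have nfP : neg (f P).
  move=> y; apply: nnP => p.
  (* With [p] at hand, the goal [f P -> Empty_set] rewrites to [Empty_set -> Empty_set]. *)
  by move: y; rewrite (inhabited_prop_eq pe P propP p) f1.
(* The goal is the type [P] itself, so rewriting along this equation leaves [unit] to inhabit. *)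
have -> : P = unit by apply: f_lc; rewrite f1; exact: empty_eq.
exact: tt.
Qed.
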